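(* Let $\Lambda$ be a row-finite $k$-graph without sources. If the talented monoid $T_\Lambda$ is atomic, then it is a unique factorization monoid.
   Context: **$k$-graphs.** $\mathbb{N}=\{0,1,2,\dots\}$, $k\ge 1$, $e_i$ is the $i$-th standard generator of $\mathbb{N}^k$. A $k$-graph is a countable small category $\Lambda$ with object set $\Lambda^0$ (identified with the identity morphisms), range and source maps $r,s:\Lambda\to\Lambda^0$, and a functor $d:\Lambda\to\mathbb{N}^k$ with the unique factorization property: if $d(\lambda)=m+n$ there are unique $\mu_1,\mu_2\in\Lambda$ with $\lambda=\mu_1\mu_2$, $d(\mu_1)=m$, $d(\mu_2)=n$ (the product $\mu_1\mu_2$ is defined iff $s(\mu_1)=r(\mu_2)$). $v\Lambda^n=\{\lambda: r(\lambda)=v, d(\lambda)=n\}$. $\Lambda$ is row-finite if every $v\Lambda^n$ is finite, and has no sources if every $v\Lambda^n$ is nonempty. **Talented monoid.** $T_\Lambda$ is the commutative monoid generated by symbols $v(n)$ ($v\in\Lambda^0$, $n\in\mathbb{Z}^k$) subject to $v(n)=\sum_{\alpha\in v\Lambda^{e_i}}s(\alpha)(n+e_i)$ for all $v$, $n$ and $i\in\{1,\dots,k\}$ with $v\Lambda^{e_i}\neq\emptyset$. **Monoids.** In a commutative monoid $M$ put $x\le y$ iff $y=x+z$ for some $z\in M$. A unit is an element $u\le 0$; a nonunit $a$ is an atom if $a=b+c$ implies $b$ or $c$ is a unit; $M$ is atomic if every nonunit is a finite sum of atoms. A nonunit $x$ has a unique factorization into atoms if it is a sum of atoms and whenever $x=a_1+\dots+a_m=a_1'+\dots+a_n'$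 with all $a_i,a_j'$ atoms, then $m=n$ and there is a permutation $\pi\in S_n$ with $a_i\le a'_{\pi(i)}$ and $a'_{\pi(i)}\le a_i$ for all $i$. $M$ is a unique factorization monoid if it is atomic and every nonunit has a unique factorization into atoms. *)

(* Defs.v *)
From HB Require Import structures.
From mathcomp Require Import all_boot all_algebra.
From mathcomp Require Import perm finmap multiset.
From mathcomp Require Import boolp classical_sets functions cardinality fsbigop.

Set Implicit Arguments.
Unset Strict Implicit.
Unset Printing Implicit Defensive.

Import GRing.Theory.
Local Open Scope ring_scope.
Local Open Scope classical_set_scope.
Local Open Scope quotient_scope.

(* Countability is carried by [countType]. The composite [mcomp a b] is only
   meaningful when [src a = rng b]; its values elsewhere are irrelevant. *)
Record kgraph (k : nat) := KGraph {
  obj : countType;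
  mor : countType;
  idm : obj -> mor;
  rng : mor -> obj;
  src : mor -> obj;
  mcomp : mor -> mor -> mor;
  deg : mor -> 'rV[nat]_k;
  rng_id : forall v, rng (idm v) = v;
  src_id : forall v, src (idm v) = v;
  rng_comp : forall a b, src a = rng b -> rng (mcomp a b) = rng a;
  src_comp : forall a b, src a = rng b -> src (mcomp a b) = src b;
  comp_idl : forall a, mcomp (idm (rng a)) a = a;
  comp_idr : forall a, mcomp a (idm (src a)) = a;
  comp_assoc : forall a b c, src a = rng b -> src b = rng c ->
    mcomp a (mcomp b c) = mcomp (mcomp a b) c;
  deg_id : forall v, deg (idm v) = 0;
  deg_comp : forall a b, src a = rng b -> deg (mcomp a b) = deg a + deg b;
  factorization : forall (l : mor) (m n : 'rV[nat]_k), deg l = m + n ->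
    exists! p : mor * mor,
      [/\ src p.1 = rng p.2, l = mcomp p.1 p.2, deg p.1 = m & deg p.2 = n]
}.

Section KGraph.
Variables (k : nat) (L : kgraph k).

(* v Lambda^n *)
Definition vpaths (v : obj L) (n : 'rV[nat]_k) : set (mor L) :=
  [set l | rng l = v /\ deg l = n].

Definition row_finite : Prop := forall v n, finite_set (vpaths v n).

Definition no_sources : Prop := forall v n, vpaths v n !=set0.

End KGraph.

(* The free commutative monoid on [K]: finite multisets under sum. *)
Definition freecm (K : choiceType) := {mset K}%mset.

Section FreeCM.
Variable K : choiceType.

HB.instance Definition _ := Choice.on (freecm K).

Fact freecm_addA : associative (@msetD K : freecm K -> freecm K -> freecm K).
Proof. by move=> A B C; rewrite msetDA. Qed.

Fact freecm_addC : commutative (@msetD K : freecm K -> freecm K -> freecm K).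
Proof. by move=> A B; rewrite msetDC. Qed.

Fact freecm_add0 :
  left_id (@mset0 K) (@msetD K : freecm K -> freecm K -> freecm K).
Proof. by move=> A; rewrite mset0D. Qed.

HB.instance Definition _ :=
  GRing.isNmodule.Build (freecm K) freecm_addA freecm_addC freecm_add0.

Definition fgen (x : K) : freecm K := [mset x]%mset.

End FreeCM.

Section Quotient.
Variables (M : nmodType) (R : M -> M -> Prop).

(* The smallest monoid congruence on [M] containing [R]. *)
Inductive ncong : M -> M -> Prop :=
| ncong_rel x y : R x y -> ncong x y
| ncong_refl x : ncong x x
| ncong_sym x y : ncong x y -> ncong y x
| ncong_trans x y z : ncong x y -> ncong y z -> ncong x z
| ncong_add x y z t : ncong x y -> ncong z t -> ncong (x + z) (y + t).

Definition ncongb : rel M := fun x y => `[< ncong x y >].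

Fact ncongb_refl : reflexive ncongb.
Proof. by move=> x; apply/asboolP; exact: ncong_refl. Qed.

Fact ncongb_sym : symmetric ncongb.
Proof. by move=> x y; apply/asboolP/asboolP; exact: ncong_sym. Qed.

Fact ncongb_trans : transitive ncongb.
Proof.
by move=> y x z /asboolP xy /asboolP yz; apply/asboolP; exact: ncong_trans yz.
Qed.

Canonical ncongb_equiv := EquivRel ncongb ncongb_refl ncongb_sym ncongb_trans.

Definition nquot := {eq_quot ncongb}.

HB.instance Definition _ := Choice.on nquot.
HB.instance Definition _ := EqQuotient.on nquot.

Lemma nquotP (x y : M) : \pi_nquot x = \pi_nquot y <-> ncong x y.
Proof.
split=> [/eqmodP|xy]; first by move/asboolP.
by apply/eqmodP/asboolP.
Qed.

Definition nquot_add (a b : nquot) : nquot := \pi_nquot (repr a + repr b).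

Lemma pi_nquot_add (x y : M) :
  nquot_add (\pi_nquot x) (\pi_nquot y) = \pi_nquot (x + y).
Proof. by apply/nquotP; apply: ncong_add; apply/nquotP; rewrite (@reprK _ nquot). Qed.

Fact nquot_addA : associative nquot_add.
Proof.
move=> a b c; rewrite -[a](@reprK _ nquot) -[b](@reprK _ nquot).
by rewrite -[c](@reprK _ nquot) !pi_nquot_add addrA.
Qed.

Fact nquot_addC : commutative nquot_add.
Proof. by move=> a b; rewrite /nquot_add addrC. Qed.

Fact nquot_add0 : left_id (\pi_nquot 0) nquot_add.
Proof. by move=> a; rewrite -[a](@reprK _ nquot) pi_nquot_add add0r. Qed.

HB.instance Definition _ :=
  GRing.isNmodule.Build nquot nquot_addA nquot_addC nquot_add0.

Lemma nquot_piD (x y : M) : \pi_nquot (x + y) = \pi_nquot x + \pi_nquot y.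
Proof. by rewrite -pi_nquot_add. Qed.

End Quotient.

Section Talented.
Variables (k : nat) (L : kgraph k).

Definition talented_symbol : choiceType := (obj L * 'rV[int]_k)%type.

(* The symbol v(n). *)
Definition vsym (v : obj L) (n : 'rV[int]_k) : freecm talented_symbol :=
  fgen ((v, n) : talented_symbol).

(* Every [vsym] is nonzero, so for row-finite [L] the finitely supported sum
   below runs over all of v Lambda^{e_i}. *)
Inductive talented_rel :
    freecm talented_symbol -> freecm talented_symbol -> Prop :=
| TalentedRel (v : obj L) (n : 'rV[int]_k) (i : 'I_k) :
    vpaths v (delta_mx 0 i) !=set0 ->
    talented_rel (vsym v n)
      (\sum_(a \in vpaths v (delta_mx 0 i)) vsym (src a) (n + delta_mx 0 i)).

Definition talented_monoid : nmodType := nquot talented_rel.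

End Talented.

Section Monoid.
Variable M : nmodType.

Definition alg_le (x y : M) : Prop := exists z, y = x + z.

Definition is_unit (u : M) : Prop := alg_le u 0.

Definition is_atom (a : M) : Prop :=
  ~ is_unit a /\ forall b c, a = b + c -> is_unit b \/ is_unit c.

Definition sum_of_atoms (x : M) : Prop :=
  exists (n : nat) (a : 'I_n -> M),
    (forall i, is_atom (a i)) /\ x = \sum_(i < n) a i.

Definition atomic : Prop := forall x : M, ~ is_unit x -> sum_of_atoms x.

Definition unique_factorization (x : M) : Prop :=
  sum_of_atoms x /\
  forall (m n : nat) (a : 'I_m -> M) (a' : 'I_n -> M),
    (forall i, is_atom (a i)) -> (forall j, is_atom (a' j)) ->
    x = \sum_(i < m) a i -> x = \sum_(j < n) a' j ->
    exists (eq_mn : m = n) (p : 'S_n), forall i : 'I_m,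
      alg_le (a i) (a' (p (cast_ord eq_mn i))) /\
      alg_le (a' (p (cast_ord eq_mn i))) (a i).

Definition ufm : Prop :=
  atomic /\ forall x : M, ~ is_unit x -> unique_factorization x.

End Monoid.

(* Main.v *)
Require Import Defs.
From mathcomp Require Import all_boot all_order all_algebra.
From mathcomp Require Import perm finmap multiset zify.
From mathcomp Require Import classical_sets cardinality fsbigop.

(** The talented monoid is a directed colimit of free commutative monoids, and
    the free commutative monoids already have the two properties that make
    factorizations into atoms unique.

    A commutative monoid is conical if [x + y = 0] forces [x = 0], and has
    refinement if any equation [a + b = c + d] comes from a 2 x 2 matrix with
    row sums [a], [b] and column sums [c], [d]. In a conical refinement monoid,
    an atom that is a summand of a sum of atoms is one of these atoms, and can
    be cancelled there ([atom_add_sum]), even if the monoid is not cancellative.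
    Two factorizations into atoms of one element are therefore permutations of
    each other ([perm_eq_atoms]), with equal, not only mutually comparable,
    matching factors.

    It remains to see that the talented monoid is conical and has refinement.
    For a level [N] in Z^k, replace each symbol v(n) by the sum of the s(a)(N)
    over the paths a with range v and degree N - n; this extends to an additive
    endomorphism of the free monoid on the symbols. Unique factorization of
    paths makes it respect the defining relations once [N] is large
    ([level_ncong]); since there are no sources, an element is congruent to its
    image once [N] is large ([ncong_level]). So finitely many equations in the
    talented monoid can be lifted to a common level, where they hold in a free
    monoid; zero sums and refinements are computed there, and pushed back. *)

Set Implicit Arguments.
Unset Strict Implicit.
Unset Printing Implicit Defensive.

Import Order.TTheory GRing.Theory.
Local Open Scope ring_scope.

(** * Unique factorization in conical refinement monoids *)

(** Zero is not a sum of nonzero elements; in particular it is the only unit. *)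
Definition conical (M : nmodType) : Prop := forall x y : M, x + y = 0 -> x = 0.

(** The Riesz refinement property: [p, q; r, s] is a matrix with row sums [a], [b]
    and column sums [c], [d]. *)
Definition refinement (M : nmodType) : Prop :=
  forall a b c d : M, a + b = c + d ->
  exists p q r s, [/\ a = p + q, b = r + s, c = p + r & d = q + s].

Lemma conical_unit (M : nmodType) (u : M) : conical M -> is_unit u -> u = 0.
Proof. by move=> cM [z /esym]; apply: cM. Qed.

Lemma atom_neq0 (M : nmodType) (a : M) : is_atom a -> a <> 0.
Proof. by case=> aN _ a0; apply: aN; exists 0; rewrite a0 addr0. Qed.

Lemma alg_le_refl (M : nmodType) (x : M) : alg_le x x.
Proof. by exists 0; rewrite addr0. Qed.

(** Atoms are prime in a conical refinement monoid, in a form that also cancels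
    the atom. *)
Lemma atom_add_sum (M : nmodType) (a x : M) (t : seq M) :
    conical M -> refinement M -> is_atom a ->
    (forall b, b \in t -> is_atom b) -> a + x = \sum_(b <- t) b ->
  exists2 t', perm_eq t (a :: t') & x = \sum_(b <- t') b.
Proof.
move=> cM rM aA; elim: t x => [|b t IH] x tA.
  by rewrite big_nil => /cM /(atom_neq0 aA).
rewrite big_cons => /rM[p [q [r [s [apq xrs bpr tqs]]]]].
have bA : is_atom b by apply: tA; rewrite mem_head.
(* Either a lies below the sum of t, and induction applies, or a lies below b;
   then a = b, because b is an atom. *)
case: (aA.2 _ _ apq) => /(conical_unit cM) z0.
  move: apq bpr; rewrite z0 !add0r => aq br.
  have [|t' tt' st'] := IH s _ (etrans (congr1 (+%R^~ s) aq) (esym tqs)).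
    by move=> c ct; apply: tA; rewrite inE ct orbT.
  exists (b :: t'); last by rewrite big_cons xrs br st'.
  rewrite -(perm_cons b) in tt'; apply: (perm_trans tt').
  by rewrite (perm_catCA [:: b] [:: a] t').
move: apq tqs; rewrite z0 addr0 add0r => ap ts.
case: (bA.2 _ _ bpr) => /(conical_unit cM) w0.
  by case: (atom_neq0 aA); rewrite ap.
by exists t; [rewrite bpr ap w0 addr0 | rewrite xrs ts w0 add0r].
Qed.

Lemma perm_eq_atoms (M : nmodType) (s t : seq M) :
    conical M -> refinement M ->
    (forall a, a \in s -> is_atom a) -> (forall b, b \in t -> is_atom b) ->
  \sum_(a <- s) a = \sum_(b <- t) b -> perm_eq s t.
Proof.
move=> cM rM; elim: s t => [|a s IH] t sA tA.
  case: t tA => // b t tA; rewrite big_nil big_cons => /esym /cM b0.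
  by case: (atom_neq0 (tA b (mem_head _ _))).
rewrite big_cons => /(atom_add_sum cM rM (sA a (mem_head _ _)) tA)[t' tt' st'].
rewrite perm_sym (perm_trans tt')// perm_cons perm_sym; apply: IH => // b bs.
  by apply: sA; rewrite inE bs orbT.
by apply: tA; rewrite (perm_mem tt') inE bs orbT.
Qed.

Lemma refinement_ufm (M : nmodType) :
  conical M -> refinement M -> atomic M -> ufm M.
Proof.
move=> cM rM atM; split=> // x xN; split; first exact: atM.
move=> m n a a' aA a'A xa xa'.
have sE k (b : 'I_k -> M) :
    \sum_(c <- [tuple b i | i < k]) c = \sum_(i < k) b i.
  by rewrite big_map big_enum.
have tA k (b : 'I_k -> M) : (forall i, is_atom (b i)) ->
    forall c, c \in [tuple b i | i < k] -> is_atom c.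
  by move=> bA c /mapP[i _ ->].
have := perm_eq_atoms cM rM (tA _ _ aA) (tA _ _ a'A).
rewrite !sE -xa -xa' => /(_ erefl) pq.
have mn : m = n by have := perm_size pq; rewrite !size_tuple.
case: _ / mn in a' a'A xa' pq *; exists erefl.
have /tuple_permP[p ap] := pq; exists p => i.
suff -> : a i = a' (p (cast_ord erefl i)) by split; exact: alg_le_refl.
rewrite cast_ord_id.
by have /val_inj/(congr1 (fun t => tnth t i)) := ap; rewrite !tnth_mktuple.
Qed.

(** * Free commutative monoids *)

Section Free.
Variable K : choiceType.

Lemma freecmDE (x y : freecm K) (a : K) :
  (x + y : {mset K}%mset) a = ((x : {mset K}%mset) a + (y : {mset K}%mset) a)%N.
Proof. by rewrite [LHS]msetE2. Qed.

Lemma freecm_conical : conical (freecm K).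
Proof.
move=> x y xy0; apply/msetP => a.
have := congr1 (fun z : {mset K}%mset => z a) xy0.
by rewrite freecmDE mset0E; lia.
Qed.

Lemma freecm_refinement : refinement (freecm K).
Proof.
move=> a b c d abcd.
(* Multiplicitywise, the upper left entry of the matrix is min(a, c), and this
   determines the other entries. *)
exists (msetI a c : freecm K), (msetB a c : freecm K), (msetB c a : freecm K).
exists (msetB b (msetB c a) : freecm K).
have E z : (a z + b z = c z + d z)%N.
  by have := congr1 (fun t : {mset K}%mset => t z) abcd; rewrite !freecmDE.
split; apply/msetP => z; have := E z; rewrite freecmDE !msetE2; lia.
Qed.

Lemma freecm_sumE (s : seq K) : \sum_(a <- s) fgen a = (seq_mset s : freecm K).
Proof.
apply/msetP => b; rewrite mset_seqE; elim: s => [|a s IH].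
  by rewrite big_nil mset0E.
by rewrite big_cons freecmDE IH msetnE /= [in RHS]eq_sym; case: eqVneq.
Qed.

Lemma freecm_decomp (x : freecm K) :
  x = \sum_(a <- (x : {mset K}%mset)) fgen a.
Proof. by rewrite freecm_sumE [RHS]seq_mset_id. Qed.

(** The additive map extending [g]: the universal property of [freecm K]. *)
Definition freecm_lift (N : nmodType) (g : K -> N) (x : freecm K) : N :=
  \sum_(a <- (x : {mset K}%mset)) g a.

Variables (N : nmodType) (g : K -> N).

Lemma freecm_lift0 : freecm_lift g 0 = 0.
Proof. exact: big_mset0. Qed.

Lemma freecm_liftD x y :
  freecm_lift g (x + y) = freecm_lift g x + freecm_lift g y.
Proof.
rewrite /freecm_lift -big_cat; apply: perm_big; apply/allP => a _ /=.
by rewrite count_cat !count_mem_mset; apply/eqP; exact: freecmDE.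
Qed.

Lemma freecm_lift_gen a : freecm_lift g (fgen a) = g a.
Proof. by rewrite /freecm_lift /fgen enum_msetn big_cons big_nil addr0. Qed.

Lemma freecm_lift_sum (I : Type) (s : seq I) (F : I -> freecm K) :
  freecm_lift g (\sum_(i <- s) F i) = \sum_(i <- s) freecm_lift g (F i).
Proof. by apply: (big_morph _ freecm_liftD freecm_lift0). Qed.

End Free.

(** * Sums over paths of a given degree *)

Section Paths.
Variables (k : nat) (L : kgraph k).
Implicit Types (v : obj L) (m n p : 'rV[nat]_k).

(** The only paths of degree 0 are the vertices: [l = id l = l id] are two
    factorizations of [l] in degrees 0 and 0. *)
Lemma vpaths0 v : vpaths v 0 = [set idm v]%classic.
Proof.
apply/seteqP; split=> [l [rv d0]|_ ->]; last first.
  by split; [exact: rng_id | exact: deg_id].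
have dE : deg l = 0 + 0 by rewrite addr0.
have [q [_ qU]] := factorization dE.
have q1 : q = (idm (rng l), l).
  by apply: qU; rewrite /= src_id comp_idl deg_id.
have q2 : q = (l, idm (src l)).
  by apply: qU; rewrite /= rng_id comp_idr deg_id.
by rewrite /= -rv; exact: esym (congr1 fst (etrans (esym q1) q2)).
Qed.

(** By unique factorization, the paths of degree [m + n] with range [v] are the
    composites of a path [a] of degree [m] with range [v] and a path of degree
    [n] with range [src a]. *)
Lemma fsum_vpathsD (N : nmodType) v m n (F : obj L -> N) : row_finite L ->
  \sum_(l \in vpaths v (m + n)) F (src l) =
  \sum_(a \in vpaths v m) \sum_(b \in vpaths (src a) n) F (src b).
Proof.
move=> fL; have fP (w : obj L) p : finite_set (vpaths w p) by exact: fL.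
pose P (w : obj L) p := fset_set (vpaths w p).
have inP w p l : l \in P w p <-> rng l = w /\ deg l = p.
  by rewrite in_fset_set // inE.
rewrite !fsbig_finite //.
transitivity
  (\sum_(l <- [seq mcomp a b | a <- P v m, b <- P (src a) n]) F (src l)).
  apply: perm_big; apply: uniq_perm; first exact: fset_uniq.
    apply: allpairs_uniq_dep => [|a _|]; rewrite ?fset_uniq //.
    move=> x y /allpairsPdep[a [b [/inP[ra da] /inP[rb db] ->]]].
    move=> /allpairsPdep[a' [b' [/inP[ra' da'] /inP[rb' db'] ->]]] /= e {x y}.
    have dE : deg (mcomp a b) = m + n by rewrite deg_comp // da db.
    have [q [_ qU]] := factorization dE.
    have q1 : q = (a, b) by apply: qU; split.
    have q2 : q = (a', b') by apply: qU; split.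
    by move: (etrans (esym q1) q2) => [-> ->].
  move=> l; apply/idP/allpairsPdep
    => [/inP[rl dl]|[a [b [/inP[ra da] /inP[rb db] ->]]]].
    have [[a b] [[/= sab lE da db] _]] := factorization dl.
    exists a, b; split=> //; apply/inP; split=> //.
    by rewrite -rl lE rng_comp.
  by apply/inP; rewrite rng_comp // deg_comp // da db.
rewrite big_allpairs_dep; apply: eq_big_seq => a _; rewrite fsbig_finite //.
by apply: eq_big_seq => b /inP[rb _]; rewrite src_comp.
Qed.

End Paths.

Lemma ncong_sum (M : nmodType) (R : M -> M -> Prop) (I : eqType) (s : seq I)
    (F G : I -> M) : (forall i, i \in s -> ncong R (F i) (G i)) ->
  ncong R (\sum_(i <- s) F i) (\sum_(i <- s) G i).
Proof.
move=> FG; rewrite big_seq [X in ncong _ _ X]big_seq.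
apply: big_ind2 => //; [exact: ncong_refl | by move=> *; exact: ncong_add].
Qed.

(** * The talented monoid at a given level *)

Section Levels.
Variables (k : nat) (L : kgraph k).
Hypotheses (fL : row_finite L) (nsL : no_sources L).
Implicit Types (v : obj L) (p q : 'rV[nat]_k) (n N : 'rV[int]_k).

Local Notation F := (freecm (talented_symbol L)).
Local Notation "x ~ y" := (ncong (@talented_rel k L) x y) (at level 70).

(** The product order of Z^k. *)
Definition row_le n N : Prop := forall j, n 0 j <= N 0 j.

Lemma row_le_trans n1 n2 n3 : row_le n1 n2 -> row_le n2 n3 -> row_le n1 n3.
Proof. by move=> le12 le23 j; exact: le_trans (le23 j). Qed.

Lemma row_le_max n1 n2 : exists N, row_le n1 N /\ row_le n2 N.
Proof.
exists (\row_j Num.max (n1 0 j) (n2 0 j)).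
by split=> j; rewrite mxE le_max lexx ?orbT.
Qed.

(** The sum of the s(a)(n + p) over the paths a of degree [p] with range
    [v]. *)
Definition expand n p v : F :=
  \sum_(a \in vpaths v p) vsym (src a) (n + map_mx Posz p).

(** The defining relations are the case where [p] is a generator; other degrees
    are sums of generators. *)
Lemma vsym_expand v n p : vsym v n ~ expand n p v.
Proof.
have -> : p = \sum_i delta_mx 0 i *+ p 0 i.
  apply/rowP => j; rewrite summxE (bigD1 j) //= mulmxnE mxE !eqxx.
  rewrite big1 ?addr0; first by rewrite -[LHS]natn.
  by move=> i ij; rewrite mulmxnE mxE eqxx eq_sym (negPf ij) mul0rn.
pose Q p := forall v n, vsym v n ~ expand n p v.
have Q0 : Q 0.
  move=> {}v {}n; rewrite /expand vpaths0 fsbig_set1 src_id.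
  have -> : map_mx Posz (0 : 'rV[nat]_k) = 0 by apply/rowP => j; rewrite !mxE.
  by rewrite addr0; exact: ncong_refl.
have QD p1 p2 : Q p1 -> Q p2 -> Q (p1 + p2).
  move=> Q1 Q2 {}v {}n; apply: (ncong_trans (Q1 v n)).
  have nE : n + map_mx Posz (p1 + p2) = n + map_mx Posz p1 + map_mx Posz p2.
    by apply/rowP => j; rewrite !mxE PoszD addrA.
  have fP : finite_set (vpaths v p1) by exact: fL.
  have -> : expand n (p1 + p2) v = \sum_(a <- fset_set (vpaths v p1))
      expand (n + map_mx Posz p1) p2 (src a).
    by rewrite /expand nE (fsum_vpathsD v p1 p2 (vsym (L := L) ^~ _) fL)
      fsbig_finite.
  rewrite {1}/expand fsbig_finite //.
  by apply: ncong_sum => a _; exact: Q2.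
apply: (big_ind Q) => // i _.
have Q1 : Q (delta_mx 0 i).
  move=> {}v {}n; rewrite /expand.
  have -> : map_mx Posz (delta_mx 0 i : 'rV[nat]_k) = delta_mx 0 i.
    by apply/rowP => j; rewrite !mxE; case: (_ && _).
  by apply: ncong_rel; constructor; exact: nsL.
by elim: (p 0 i) => [|d IH]; rewrite ?mulr0n // mulrS; exact: QD.
Qed.

(** The expression of v(n) at level [N], where s = (v, n). It is only meaningful
    for [n <= N]; elsewhere the absolute value makes it an arbitrary element,
    which plays no role because levels are always taken large enough. *)
Definition level N (s : talented_symbol L) : F :=
  \sum_(a \in vpaths s.1 (map_mx absz (N - s.2))) vsym (src a) N.

Lemma level_expand N v n : row_le n N ->
  level N (v, n) = expand n (map_mx absz (N - n)) v.
Proof.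
move=> nN; rewrite /level /expand /=.
suff -> : n + map_mx Posz (map_mx absz (N - n)) = N by [].
apply/rowP => j; rewrite !mxE.
have absK (a b : int) : a <= b -> a + Posz (absz (b - a)) = b by lia.
exact: absK (nN j).
Qed.

(** [level N] respects the defining relations as soon as it is meaningful on
    both sides. *)
Lemma level_rel N v n (i : 'I_k) : row_le (n + delta_mx 0 i) N ->
  level N (v, n) =
  \sum_(a \in vpaths v (delta_mx 0 i)) level N (src a, n + delta_mx 0 i).
Proof.
move=> nN; rewrite /level /=.
have -> : map_mx absz (N - n) =
    delta_mx 0 i + map_mx absz (N - (n + delta_mx 0 i)) :> 'rV[nat]_k.
  apply/rowP => j; have := nN j; rewrite !mxE.
  have abs_split (a b : int) (c : bool) : a + c%:R <= b ->
      absz (b - a)%R = addn c%:R (absz (b - (a + c%:R))%R) by case: c => /=; lia.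
  exact: abs_split.
exact: (fsum_vpathsD _ _ _ (fun w => vsym w N)).
Qed.

(** The threshold bounds the degrees of the symbols that occur in [x]. *)
Lemma ncong_level (x : F) :
  exists N0, forall N, row_le N0 N -> x ~ freecm_lift (level N) x.
Proof.
rewrite [x]freecm_decomp; elim: (EnumMset.f x) => [|[v n] s [N1 IH]].
  exists 0 => N _; rewrite big_nil freecm_lift0; exact: ncong_refl.
have [N0 [nN0 N10]] := row_le_max n N1; exists N0 => N leN.
rewrite big_cons freecm_liftD freecm_lift_gen; apply: ncong_add.
  by rewrite level_expand; [exact: vsym_expand | exact: row_le_trans leN].
by apply: IH; exact: row_le_trans leN.
Qed.

(** A derivation of a congruence uses finitely many relations, all of which are
    respected by high enough levels. *)
Lemma level_ncong (x y : F) : x ~ y -> exists N0, forall N, row_le N0 N ->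
  freecm_lift (level N) x = freecm_lift (level N) y.
Proof.
elim=> {x y}.
- move=> _ _ [v n i _]; exists (n + delta_mx 0 i) => N leN.
  rewrite freecm_lift_gen (level_rel v leN) fsbig_finite; last exact: fL.
  rewrite fsbig_finite; last exact: fL.
  by rewrite freecm_lift_sum; apply: eq_bigr => a _; rewrite freecm_lift_gen.
- by exists 0.
- by move=> x y _ [N0 IH]; exists N0 => N /IH.
- move=> x y z _ [N1 IH1] _ [N2 IH2]; have [N0 [le1 le2]] := row_le_max N1 N2.
  by exists N0 => N leN; rewrite IH1 ?IH2 //; exact: row_le_trans leN.
- move=> x y z t _ [N1 IH1] _ [N2 IH2]; have [N0 [le1 le2]] := row_le_max N1 N2.
  exists N0 => N leN; rewrite !freecm_liftD IH1 ?IH2 //; exact: row_le_trans leN.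
Qed.

Local Notation T := (talented_monoid L).
Local Notation piT := (\pi_(nquot (@talented_rel k L))%qT).

Lemma pi_level (x : F) : exists N0, forall N, row_le N0 N ->
  piT x = piT (freecm_lift (level N) x).
Proof.
by have [N0 H] := ncong_level x; exists N0 => N /H H'; apply/nquotP.
Qed.

Lemma pi_repr (x : T) : exists y : F, x = piT y.
Proof. by exists (repr x); rewrite reprK. Qed.

Lemma talented_conical : conical T.
Proof.
move=> x y; have [a ->] := pi_repr x; have [b ->] := pi_repr y.
rewrite -nquot_piD => /(@nquotP _ _ _ 0)/level_ncong[N1 H1].
have [N2 H2] := pi_level a; have [N [/H1 + /H2 ->]] := row_le_max N1 N2.
by rewrite freecm_liftD freecm_lift0 => /freecm_conical ->.
Qed.

Lemma talented_refinement : refinement T.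
Proof.
move=> a b c d; have [x ->] := pi_repr a; have [y ->] := pi_repr b.
have [z ->] := pi_repr c; have [t ->] := pi_repr d.
rewrite -!nquot_piD => /nquotP/level_ncong[N0 H0].
have [Nx Hx] := pi_level x; have [Ny Hy] := pi_level y.
have [Nz Hz] := pi_level z; have [Nt Ht] := pi_level t.
(* N is a level at which the equation and all four representatives hold. *)
have [N1 [l10 l1x]] := row_le_max N0 Nx; have [N2 [l21 l2y]] := row_le_max N1 Ny.
have [N3 [l32 l3z]] := row_le_max N2 Nz; have [N [lN3 lNt]] := row_le_max N3 Nt.
have lN2 := row_le_trans l32 lN3; have lN1 := row_le_trans l21 lN2.
have := H0 N (row_le_trans l10 lN1); rewrite !freecm_liftD.
move=> /freecm_refinement[p [q [r [s [xE yE zE tE]]]]].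
exists (piT p), (piT q), (piT r), (piT s).
rewrite (Hx N) 1?(Hy N) 1?(Hz N) 1?(Ht N) ?xE ?yE ?zE ?tE ?nquot_piD //.
all: by [exact: row_le_trans lN1 | exact: row_le_trans lN2
        | exact: row_le_trans lN3].
Qed.

End Levels.

Theorem lemma5p8 (k : nat) (k_gt0 : (0 < k)%N) (L : kgraph k) :
  row_finite L -> no_sources L ->
  atomic (talented_monoid L) -> ufm (talented_monoid L).
Proof.
move=> fL nsL.
by apply: refinement_ufm; [exact: talented_conical | exact: talented_refinement].
Qed.
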